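(* Let $k$ be a field, $H$ a bialgebra over $k$ and $(M,\cdot,\rho)$ an $H$-Hopf module. Then: 1. The map $R=R_{(M,\cdot,\rho)}:M\otimes M\to M\otimes M$, $R_{(M,\cdot,\rho)}(m\otimes n)=\sum n_{<1>}\cdot m\otimes n_{<0>}$, is a solution of the Hopf equation $R^{23}R^{13}R^{12}=R^{12}R^{23}$. 2. If $H$ is commutative, then $R=R_{(M,\cdot,\rho)}$ is a commutative solution of the Hopf equation, i.e. it is a solution of the Hopf equation and moreover $R^{12}R^{13}=R^{13}R^{12}$.
   Context: $k$ is a field; all vector spaces, algebras (associative, unital), coalgebras and bialgebras are over $k$, and $\otimes=\otimes_k$. For a linear map $R:V\otimes V\to V\otimes V$, the maps $R^{12},R^{23},R^{13}\in\mathrm{End}_k(V\otimes V\otimes V)$ are $R^{12}=R\otimes I$, $R^{23}=I\otimes R$, $R^{13}=(I\otimes\tau)(R\otimes I)(I\otimes\tau)$, where $\tau(v\otimes w)=w\otimes v$ and $I$ is the identity map. Sweedler notation: $\Delta(h)=\sum h_{(1)}\otimes h_{(2)}$ for a bialgebra $H$, and $\rho(m)=\sum m_{<0>}\otimes m_{<1>}\in M\otimes H$ for a right $H$-comodule $(M,\rho)$. Let $H$ be a bialgebra. A (left-right) $H$-Hopf module $(M,\cdot,\rho)$ is a left $H$-module $(M,\cdot)$ which is also a right $H$-comodule $(M,\rho)$ such that $\rho(h\cdot m)=\sum h_{(1)}\cdot m_{<0>}\otimes h_{(2)}m_{<1>}$ for all $h\in H$, $m\in M$. *)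

(* Defs.v *)
From HB Require Import structures.
From mathcomp Require Import all_boot all_order all_algebra.
From mathcomp Require Import boolp.

Set Implicit Arguments.
Unset Strict Implicit.
Unset Printing Implicit Defensive.

Import GRing.Theory.
Local Open Scope ring_scope.
Local Open Scope quotient_scope.

(* The tensor product over k of two (possibly infinite-dimensional) k-spaces is
   the quotient of the formal sums of pairs (u, v), written as sequences, by
   the congruence generated by the bilinearity relations.  A coefficient a of a
   pair (u, v) is absorbed as (a *: u, v), and the empty sum represents 0.     *)
Section TensorType.
Variables (k : fieldType) (U V : lmodType k).

Inductive tensor_eqv : seq (U * V) -> seq (U * V) -> Prop :=
| tensor_eqv_refl s : tensor_eqv s s
| tensor_eqv_sym s t : tensor_eqv s t -> tensor_eqv t s
| tensor_eqv_trans s t r : tensor_eqv s t -> tensor_eqv t r -> tensor_eqv s r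
| tensor_eqv_cat s s' t t' :
    tensor_eqv s s' -> tensor_eqv t t' -> tensor_eqv (s ++ t) (s' ++ t')
| tensor_eqv_catC s t : tensor_eqv (s ++ t) (t ++ s)
| tensor_eqv_0l v : tensor_eqv [:: (0, v)] [::]
| tensor_eqv_Dl u u' v : tensor_eqv [:: (u + u', v)] [:: (u, v); (u', v)]
| tensor_eqv_Dr u v v' : tensor_eqv [:: (u, v + v')] [:: (u, v); (u, v')]
| tensor_eqv_Z a u v : tensor_eqv [:: (a *: u, v)] [:: (u, a *: v)].

Definition tensor_rel : rel (seq (U * V)) := fun s t => `[< tensor_eqv s t >].

Lemma tensor_rel_refl : reflexive tensor_rel.
Proof. by move=> s; apply/asboolP; apply: tensor_eqv_refl. Qed.

Lemma tensor_rel_sym : symmetric tensor_rel.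
Proof. by move=> s t; apply/asboolP/asboolP; apply: tensor_eqv_sym. Qed.

Lemma tensor_rel_trans : transitive tensor_rel.
Proof.
move=> t s r /asboolP st /asboolP tr; apply/asboolP.
exact: tensor_eqv_trans st tr.
Qed.

Canonical tensor_equiv :=
  EquivRel tensor_rel tensor_rel_refl tensor_rel_sym tensor_rel_trans.

Definition tensor := {eq_quot tensor_rel}.
HB.instance Definition _ := Choice.on tensor.
HB.instance Definition _ := EqQuotient.on tensor.

Lemma tensorP s t : reflect (\pi_tensor s = \pi_tensor t) `[< tensor_eqv s t >].
Proof. exact: (eqmodP tensor_equiv). Qed.

Lemma tensor_eqvE s t : tensor_eqv s t <-> \pi_tensor s = \pi_tensor t.
Proof. by split => [/asboolP/tensorP|/tensorP/asboolP]. Qed.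

Definition scale_seq (a : k) (s : seq (U * V)) :=
  [seq (a *: p.1, p.2) | p <- s].

Lemma scale_seq_eqv a s t :
  tensor_eqv s t -> tensor_eqv (scale_seq a s) (scale_seq a t).
Proof.
elim=> {s t} [s|s t _ |s t r _ st _ tr|s s' t t' _ ss' _ tt'|s t|v|u u' v|
              u v v'|b u v] /=.
- exact: tensor_eqv_refl.
- exact/tensor_eqv_sym.
- exact: tensor_eqv_trans st tr.
- by rewrite /scale_seq !map_cat; apply: tensor_eqv_cat.
- by rewrite /scale_seq !map_cat; apply: tensor_eqv_catC.
- by rewrite scaler0; apply: tensor_eqv_0l.
- by rewrite scalerDr; apply: tensor_eqv_Dl.
- exact: tensor_eqv_Dr.
- by rewrite scalerA mulrC -scalerA; apply: tensor_eqv_Z.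
Qed.

Definition tensor_zero : tensor := \pi_tensor [::].
Definition tensor_add (x y : tensor) : tensor := \pi_tensor (repr x ++ repr y).
Definition tensor_scale (a : k) (x : tensor) : tensor :=
  \pi_tensor (scale_seq a (repr x)).

Lemma tensor_addE s t :
  tensor_add (\pi_tensor s) (\pi_tensor t) = \pi_tensor (s ++ t).
Proof. by apply/tensor_eqvE/tensor_eqv_cat; apply/tensor_eqvE; rewrite reprK. Qed.

Lemma tensor_scaleE a s :
  tensor_scale a (\pi_tensor s) = \pi_tensor (scale_seq a s).
Proof. by apply/tensor_eqvE/scale_seq_eqv/tensor_eqvE; rewrite reprK. Qed.

Fact tensor_addA : associative tensor_add.
Proof.
elim/quotW=> x; elim/quotW=> y; elim/quotW=> z.
by rewrite (tensor_addE y z) (tensor_addE x y) !tensor_addE catA.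
Qed.

Fact tensor_addC : commutative tensor_add.
Proof.
elim/quotW=> x; elim/quotW=> y; rewrite !tensor_addE.
exact/tensor_eqvE/tensor_eqv_catC.
Qed.

Fact tensor_add0 : left_id tensor_zero tensor_add.
Proof. by elim/quotW=> x; rewrite tensor_addE. Qed.

Lemma scale_seqDl a b s :
  tensor_eqv (scale_seq (a + b) s) (scale_seq a s ++ scale_seq b s).
Proof.
elim: s => [|[u v] s IHs] /=; first exact: tensor_eqv_refl.
rewrite scalerDl -[_ :: _ ++ _]/([:: (a *: u, v)] ++ (_ ++ _)) /=.
apply: tensor_eqv_trans
  (tensor_eqv_cat (tensor_eqv_Dl (a *: u) (b *: u) v) IHs) _ => /=.
apply: (@tensor_eqv_cat [:: _] [:: _]); first exact: tensor_eqv_refl.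
rewrite -cat1s -[in X in _ _ X]cat1s !catA.
by apply: tensor_eqv_cat; [exact: tensor_eqv_catC | exact: tensor_eqv_refl].
Qed.

Lemma scale_seq0 s : tensor_eqv (scale_seq 0 s) [::].
Proof.
elim: s => [|[u v] s IHs] /=; first exact: tensor_eqv_refl.
rewrite scale0r.
exact: (tensor_eqv_cat (tensor_eqv_0l v) IHs).
Qed.

Lemma scale_seq1 s : scale_seq 1 s = s.
Proof. by elim: s => [|[u v] s IHs] //=; rewrite scale1r IHs. Qed.

Lemma scale_seqA a b s : scale_seq a (scale_seq b s) = scale_seq (a * b) s.
Proof.
by rewrite /scale_seq -map_comp; apply: eq_map => -[u v] /=; rewrite scalerA.
Qed.

Fact tensor_addN : left_inverse tensor_zero (tensor_scale (-1)) tensor_add.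
Proof.
elim/quotW=> x; rewrite tensor_scaleE tensor_addE; apply/tensor_eqvE.
apply: tensor_eqv_trans (scale_seq0 x).
by rewrite -(addNr (1 : k)) -{2}[x]scale_seq1; apply/tensor_eqv_sym/scale_seqDl.
Qed.

HB.instance Definition _ :=
  GRing.isZmodule.Build tensor tensor_addA tensor_addC tensor_add0 tensor_addN.

Lemma pi_tensorD s t : \pi_tensor (s ++ t) = \pi_tensor s + \pi_tensor t.
Proof. exact/esym/tensor_addE. Qed.

Fact tensor_scaleA a b x :
  tensor_scale a (tensor_scale b x) = tensor_scale (a * b) x.
Proof. by elim/quotW: x => x; rewrite (tensor_scaleE b) !tensor_scaleE scale_seqA. Qed.

Fact tensor_scale1 : left_id 1 tensor_scale.
Proof. by elim/quotW=> x; rewrite tensor_scaleE scale_seq1. Qed.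

Fact tensor_scaleDr : right_distributive tensor_scale +%R.
Proof.
move=> a; elim/quotW=> x; elim/quotW=> y.
by rewrite -pi_tensorD !tensor_scaleE -pi_tensorD /scale_seq map_cat.
Qed.

Fact tensor_scaleDl x : {morph tensor_scale^~ x : a b / a + b}.
Proof.
move=> a b; elim/quotW: x => x; rewrite !tensor_scaleE -pi_tensorD.
exact/tensor_eqvE/scale_seqDl.
Qed.

HB.instance Definition _ :=
  GRing.Zmodule_isLmodule.Build k tensor
    tensor_scaleA tensor_scale1 tensor_scaleDr tensor_scaleDl.

Definition tens (u : U) (v : V) : tensor := \pi_tensor [:: (u, v)].

Lemma tensZl a u v : tens (a *: u) v = a *: tens u v.
Proof. exact/esym/tensor_scaleE. Qed.

Lemma tensZr a u v : tens u (a *: v) = a *: tens u v.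
Proof. by rewrite -tensZl; apply/esym/tensor_eqvE/tensor_eqv_Z. Qed.

Lemma tensDl u u' v : tens (u + u') v = tens u v + tens u' v.
Proof. by rewrite -pi_tensorD; apply/tensor_eqvE/tensor_eqv_Dl. Qed.

Lemma tensDr u v v' : tens u (v + v') = tens u v + tens u v'.
Proof. by rewrite -pi_tensorD; apply/tensor_eqvE/tensor_eqv_Dr. Qed.

Fact tens_is_bilinear :
  bilinear_for (GRing.Scale.Law.clone _ _ *:%R _)
               (GRing.Scale.Law.clone _ _ *:%R _) tens.
Proof.
by split=> [v|u] a x y; rewrite (tensDl, tensDr) (tensZl, tensZr).
Qed.

HB.instance Definition _ :=
  bilinear_isBilinear.Build k U V tensor _ _ tens tens_is_bilinear.


Lemma tensor_sum (x : tensor) : x = \sum_(p <- repr x) tens p.1 p.2.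
Proof.
rewrite -{1}[x]reprK; elim: (repr x) => [|[u v] s IHs]; first by rewrite big_nil.
by rewrite big_cons -IHs -pi_tensorD.
Qed.

Lemma tensor_ind (P : tensor -> Prop) :
  P 0 -> (forall u v, P (tens u v)) ->
  (forall x y, P x -> P y -> P (x + y)) -> forall x, P x.
Proof.
move=> P0 Pt PD x; rewrite [x]tensor_sum.
by elim: (repr x) => [|p s IHs]; rewrite ?big_nil ?big_cons //; apply: PD.
Qed.

End TensorType.

Arguments tensor {k} (U V)%_type_scope.

Notation "U ⊗ V" := (tensor U V) (at level 40, left associativity) : type_scope.
Notation "u ⊗ v" := (tens u v) (at level 40, left associativity) : ring_scope.

Section TensorLift.
Variables (k : fieldType) (U V W : lmodType k) (f : {bilinear U -> V -> W}).

Definition tlift (x : U ⊗ V) : W := \sum_(p <- repr x) f p.1 p.2.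

Lemma tensor_eqv_sum s t : tensor_eqv s t ->
  \sum_(p <- s) f p.1 p.2 = \sum_(p <- t) f p.1 p.2.
Proof.
elim=> {s t} [s|s t _ ->|s t r _ -> _ ->|s s' t t' _ ss' _ tt'|s t|v|u u' v|
              u v v'|b u v] //; rewrite ?big_cat ?big_cons ?big_nil /= ?addr0.
- by rewrite ss' tt'.
- by rewrite addrC.
- by rewrite linear0l.
- by rewrite linearDl.
- by rewrite linearDr.
- by rewrite linearZl_LR linearZr_LR.
Qed.

Lemma tlift_pi s : tlift (\pi_(U ⊗ V) s) = \sum_(p <- s) f p.1 p.2.
Proof. by apply/tensor_eqv_sum/tensor_eqvE; rewrite reprK. Qed.

Lemma tliftE u v : tlift (u ⊗ v) = f u v.
Proof. by rewrite tlift_pi big_seq1. Qed.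

Fact tlift_is_linear : linear tlift.
Proof.
move=> a x y; rewrite -[x]reprK -[y]reprK.
rewrite -[a *: _]/(tensor_scale a _) tensor_scaleE -pi_tensorD !tlift_pi.
rewrite big_cat big_map scaler_sumr; congr (_ + _).
by apply: eq_bigr => p _; rewrite linearZl_LR.
Qed.
HB.instance Definition _ :=
  GRing.isLinear.Build k (tensor U V) W _ tlift tlift_is_linear.

Lemma tlift_unique (g : {linear (U ⊗ V)%type -> W}) :
  (forall u v, g (u ⊗ v) = f u v) -> g =1 tlift.
Proof.
move=> gE; elim/tensor_ind => [|u v|x y gx gy]; first by rewrite !linear0.
- by rewrite gE tliftE.
- by rewrite !linearD gx gy.
Qed.

End TensorLift.

Lemma tensor_ext (k : fieldType) (U V W : lmodType k)
    (g h : {linear (U ⊗ V)%type -> W}) :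
  (forall u v, g (u ⊗ v) = h (u ⊗ v)) -> g =1 h.
Proof.
move=> gh; elim/tensor_ind => [|u v|x y gx gy]; first by rewrite !linear0.
- exact: gh.
- by rewrite !linearD gx gy.
Qed.

Lemma eq_tlift (k : fieldType) (U V W : lmodType k)
    (f g : {bilinear U -> V -> W}) : f =2 g -> tlift f =1 tlift g.
Proof. by move=> fg x; apply: eq_bigr => p _; apply: fg. Qed.

Notation is_bilinear f :=
  (bilinear_for (GRing.Scale.Law.clone _ _ *:%R _)
                (GRing.Scale.Law.clone _ _ *:%R _) f).

Section TensorMap.
Variables (k : fieldType) (U U' V V' : lmodType k).
Variables (f : {linear U -> U'}) (g : {linear V -> V'}).

Definition tmap_pure (u : U) (v : V) : U' ⊗ V' := f u ⊗ g v.

Fact tmap_pure_is_bilinear : is_bilinear tmap_pure.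
Proof.
by split=> [v|u] a x y /=; rewrite /tmap_pure linearP (linearPl, linearPr).
Qed.
HB.instance Definition _ := bilinear_isBilinear.Build k U V (tensor U' V') _ _
  tmap_pure tmap_pure_is_bilinear.

Definition tmap : U ⊗ V -> U' ⊗ V' := tlift tmap_pure.
HB.instance Definition _ := GRing.Linear.on tmap.

Lemma tmapE u v : tmap (u ⊗ v) = f u ⊗ g v.
Proof. exact: tliftE. Qed.

End TensorMap.

(* The map (x, y) |-> \sum f x_1 y_1 ⊗ g x_2 y_2 induced by two bilinear maps. *)
Section TensorBilinear.
Variables (k : fieldType) (A A' B B' C C' : lmodType k).
Variables (f : {bilinear A -> B -> C}) (g : {bilinear A' -> B' -> C'}).

Definition tmap2_pure (a : A) (a' : A') (b : B) (b' : B') : C ⊗ C' :=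
  f a b ⊗ g a' b'.

Fact tmap2_pure_is_bilinear a a' : is_bilinear (tmap2_pure a a').
Proof.
by split=> [b'|b] c x y; rewrite /tmap2_pure !linearPr ?linearPl.
Qed.
HB.instance Definition _ a a' := bilinear_isBilinear.Build k B B' (tensor C C')
  _ _ (tmap2_pure a a') (tmap2_pure_is_bilinear a a').

Definition tmap2_right (y : B ⊗ B') (a : A) (a' : A') : C ⊗ C' :=
  tlift (tmap2_pure a a') y.

Fact tmap2_right_is_bilinear y : is_bilinear (tmap2_right y).
Proof.
split=> [a'|a] c x z /=; rewrite /tmap2_right /tlift scaler_sumr -big_split;
  apply: eq_bigr => p _; rewrite /= /tmap2_pure.
  by rewrite !linearPl.
by rewrite linearPl linearPr.
Qed.
HB.instance Definition _ y := bilinear_isBilinear.Build k A A' (tensor C C')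
  _ _ (tmap2_right y) (tmap2_right_is_bilinear y).

Definition tmap2 (x : A ⊗ A') (y : B ⊗ B') : C ⊗ C' := tlift (tmap2_right y) x.

Fact tmap2_is_bilinear : is_bilinear tmap2.
Proof.
split=> [y|x] c z t /=; rewrite /tmap2; first by rewrite linearP.
rewrite /tlift scaler_sumr -big_split; apply: eq_bigr => p _ /=.
by rewrite /tmap2_right linearP.
Qed.
HB.instance Definition _ := bilinear_isBilinear.Build k (tensor A A')
  (tensor B B') (tensor C C') _ _ tmap2 tmap2_is_bilinear.

Lemma tmap2E a a' b b' : tmap2 (a ⊗ a') (b ⊗ b') = f a b ⊗ g a' b'.
Proof. by rewrite /tmap2 tliftE /= /tmap2_right tliftE. Qed.

End TensorBilinear.

Section TensorSwap.
Variables (k : fieldType) (U V : lmodType k).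

Definition tswap_pure (u : U) (v : V) : V ⊗ U := v ⊗ u.

Fact tswap_pure_is_bilinear : is_bilinear tswap_pure.
Proof. by split=> [v|u] a x y /=; rewrite /tswap_pure (linearPl, linearPr). Qed.
HB.instance Definition _ := bilinear_isBilinear.Build k U V (tensor V U) _ _
  tswap_pure tswap_pure_is_bilinear.

Definition tswap : U ⊗ V -> V ⊗ U := tlift tswap_pure.
HB.instance Definition _ := GRing.Linear.on tswap.

Lemma tswapE u v : tswap (u ⊗ v) = v ⊗ u.
Proof. exact: tliftE. Qed.

End TensorSwap.

Section TensorAssoc.
Variables (k : fieldType) (U V W : lmodType k).

Definition tassoc_pure (w : W) (u : U) (v : V) : U ⊗ (V ⊗ W) := u ⊗ (v ⊗ w).

Fact tassoc_pure_is_bilinear w : is_bilinear (tassoc_pure w).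
Proof.
by split=> [v|u] a x y /=; rewrite /tassoc_pure linearPl // linearPr.
Qed.
HB.instance Definition _ w := bilinear_isBilinear.Build k U V
  (tensor U (tensor V W)) _ _ (tassoc_pure w) (tassoc_pure_is_bilinear w).

Definition tassoc_left (x : U ⊗ V) (w : W) : U ⊗ (V ⊗ W) :=
  tlift (tassoc_pure w) x.

Fact tassoc_left_is_bilinear : is_bilinear tassoc_left.
Proof.
split=> [w|x] a y z /=; rewrite /tassoc_left; first by rewrite linearP.
rewrite /tlift scaler_sumr -big_split; apply: eq_bigr => p _ /=.
by rewrite /tassoc_pure !linearPr.
Qed.
HB.instance Definition _ := bilinear_isBilinear.Build k (tensor U V) W
  (tensor U (tensor V W)) _ _ tassoc_left tassoc_left_is_bilinear.

Definition tassoc : U ⊗ V ⊗ W -> U ⊗ (V ⊗ W) := tlift tassoc_left.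
HB.instance Definition _ := GRing.Linear.on tassoc.

Lemma tassocE u v w : tassoc (u ⊗ v ⊗ w) = u ⊗ (v ⊗ w).
Proof. by rewrite /tassoc tliftE /= /tassoc_left tliftE. Qed.

Definition tassoc_inv_pure (u : U) (v : V) (w : W) : U ⊗ V ⊗ W := u ⊗ v ⊗ w.

Fact tassoc_inv_pure_is_bilinear u : is_bilinear (tassoc_inv_pure u).
Proof.
by split=> [w|v] a x y /=; rewrite /tassoc_inv_pure linearPr // linearPl.
Qed.
HB.instance Definition _ u := bilinear_isBilinear.Build k V W
  (tensor (tensor U V) W) _ _ (tassoc_inv_pure u)
  (tassoc_inv_pure_is_bilinear u).

Definition tassoc_inv_right (u : U) (y : V ⊗ W) : U ⊗ V ⊗ W :=
  tlift (tassoc_inv_pure u) y.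

Fact tassoc_inv_right_is_bilinear : is_bilinear tassoc_inv_right.
Proof.
split=> [y|u] a x z /=; rewrite /tassoc_inv_right; last by rewrite linearP.
rewrite /tlift scaler_sumr -big_split; apply: eq_bigr => p _ /=.
by rewrite /tassoc_inv_pure !linearPl.
Qed.
HB.instance Definition _ := bilinear_isBilinear.Build k U (tensor V W)
  (tensor (tensor U V) W) _ _ tassoc_inv_right tassoc_inv_right_is_bilinear.

Definition tassoc_inv : U ⊗ (V ⊗ W) -> U ⊗ V ⊗ W := tlift tassoc_inv_right.
HB.instance Definition _ := GRing.Linear.on tassoc_inv.

Lemma tassoc_invE u v w : tassoc_inv (u ⊗ (v ⊗ w)) = u ⊗ v ⊗ w.
Proof. by rewrite /tassoc_inv tliftE /= /tassoc_inv_right tliftE. Qed.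

Lemma tassocK : cancel tassoc tassoc_inv.
Proof.
move=> x; elim/tensor_ind: x => [|x w|x y IHx IHy].
- by rewrite !linear0.
- elim/tensor_ind: x => [|u v|x y IHx IHy].
  + by rewrite linear0l !linear0.
  + by rewrite tassocE tassoc_invE.
  + by rewrite linearDl /= !linearD /= IHx IHy.
- by rewrite !linearD /= IHx IHy.
Qed.

Lemma tassoc_invK : cancel tassoc_inv tassoc.
Proof.
move=> x; elim/tensor_ind: x => [|u x|x y IHx IHy].
- by rewrite !linear0.
- elim/tensor_ind: x => [|v w|x y IHx IHy].
  + by rewrite linear0r !linear0.
  + by rewrite tassoc_invE tassocE.
  + by rewrite linearDr /= !linearD /= IHx IHy.
- by rewrite !linearD /= IHx IHy.
Qed.

End TensorAssoc.

Section TensorUnit.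
Variables (k : fieldType) (V : lmodType k).

Definition scale_left (a : k^o) (v : V) : V := a *: v.
Definition scale_right (v : V) (a : k^o) : V := a *: v.

Fact scale_left_is_bilinear : is_bilinear scale_left.
Proof.
split=> [v|b] a x y /=; rewrite /scale_left; first by rewrite scalerDl scalerA.
by rewrite scalerDr !scalerA mulrC.
Qed.
HB.instance Definition _ := bilinear_isBilinear.Build k k^o V V _ _
  scale_left scale_left_is_bilinear.

Fact scale_right_is_bilinear : is_bilinear scale_right.
Proof. by split=> [b|v] a x y; apply scale_left_is_bilinear. Qed.
HB.instance Definition _ := bilinear_isBilinear.Build k V k^o V _ _
  scale_right scale_right_is_bilinear.

Definition tunitl : k^o ⊗ V -> V := tlift scale_left.
HB.instance Definition _ := GRing.Linear.on tunitl.

Definition tunitr : V ⊗ k^o -> V := tlift scale_right.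
HB.instance Definition _ := GRing.Linear.on tunitr.

Lemma tunitlE a v : tunitl (a ⊗ v) = a *: v.
Proof. exact: tliftE. Qed.

Lemma tunitrE v a : tunitr (v ⊗ a) = a *: v.
Proof. exact: tliftE. Qed.

End TensorUnit.

Section AlgebraProduct.
Variables (k : fieldType) (A : algType k).

Definition alg_mul (x y : A) : A := x * y.

Fact alg_mul_is_bilinear : is_bilinear alg_mul.
Proof.
split=> [v|u] a x y /=; rewrite /alg_mul; first by rewrite mulrDl scalerAl.
by rewrite mulrDr scalerAr.
Qed.
HB.instance Definition _ := bilinear_isBilinear.Build k A A A _ _
  alg_mul alg_mul_is_bilinear.

End AlgebraProduct.

Record coalgebra (k : fieldType) (C : lmodType k) := Coalgebra {
  comul : {linear C -> (C ⊗ C)%type};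
  counit : {linear C -> k^o};
  comulA : forall c, tassoc (tmap comul idfun (comul c))
                     = tmap idfun comul (comul c);
  comul_counitl : forall c, tunitl (tmap counit idfun (comul c)) = c;
  comul_counitr : forall c, tunitr (tmap idfun counit (comul c)) = c
}.

(* comulM is multiplicativity for the componentwise product on H ⊗ H. *)
Record bialgebra (k : fieldType) (H : algType k) := Bialgebra {
  bialgebra_coalgebra :> coalgebra H;
  comul1 : comul bialgebra_coalgebra 1 = 1 ⊗ 1;
  comulM : forall g h, comul bialgebra_coalgebra (g * h)
    = tmap2 (@alg_mul k H) (@alg_mul k H)
        (comul bialgebra_coalgebra g) (comul bialgebra_coalgebra h);
  counit1 : counit bialgebra_coalgebra 1 = 1;
  counitM : forall g h, counit bialgebra_coalgebra (g * h)
    = counit bialgebra_coalgebra g * counit bialgebra_coalgebra h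
}.

(* The left A-module structures on a given k-space M that induce its k-linear
   structure through k -> A; act h m is h · m. *)
Record left_module (k : fieldType) (A : algType k) (M : lmodType k) :=
  LeftModule {
  act : {bilinear A -> M -> M};
  act1 : forall m, act 1 m = m;
  actM : forall g h m, act (g * h) m = act g (act h m)
}.

Record right_comodule (k : fieldType) (C : lmodType k) (K : coalgebra C)
    (M : lmodType k) := RightComodule {
  coact : {linear M -> (M ⊗ C)%type};
  coactA : forall m, tassoc (tmap coact idfun (coact m))
                     = tmap idfun (comul K) (coact m);
  coact_counit : forall m, tunitr (tmap idfun (counit K) (coact m)) = m
}.

Record hopf_module (k : fieldType) (H : algType k) (B : bialgebra H)
    (M : lmodType k) := HopfModule {
  hopf_left_module :> left_module H M;
  hopf_right_comodule :> right_comodule B M;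
  coact_act : forall h m, coact hopf_right_comodule (act hopf_left_module h m)
    = tmap2 (act hopf_left_module) (@alg_mul k H)
        (comul B h) (coact hopf_right_comodule m)
}.

(* R^12, R^23, R^13 on V ⊗ V ⊗ V, which is bracketed as (V ⊗ V) ⊗ V. *)
Section Legs.
Variables (k : fieldType) (V : lmodType k) (R : {linear (V ⊗ V)%type -> (V ⊗ V)%type}).

Definition leg12 : V ⊗ V ⊗ V -> V ⊗ V ⊗ V := tmap R idfun.
HB.instance Definition _ := GRing.Linear.on leg12.

Definition leg23 : V ⊗ V ⊗ V -> V ⊗ V ⊗ V :=
  @tassoc_inv k V V V \o tmap idfun R \o @tassoc k V V V.
HB.instance Definition _ := GRing.Linear.on leg23.

End Legs.

Definition leg13 (k : fieldType) (V : lmodType k)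
    (R : {linear (V ⊗ V)%type -> (V ⊗ V)%type}) : V ⊗ V ⊗ V -> V ⊗ V ⊗ V :=
  leg23 (@tswap k V V) \o leg12 R \o leg23 (@tswap k V V).
HB.instance Definition _ (k : fieldType) (V : lmodType k)
  (R : {linear (V ⊗ V)%type -> (V ⊗ V)%type}) := GRing.Linear.on (leg13 R).

Definition hopf_solution (k : fieldType) (V : lmodType k)
    (R : {linear (V ⊗ V)%type -> (V ⊗ V)%type}) : Prop :=
  leg23 R \o leg13 R \o leg12 R =1 leg12 R \o leg23 R.

Definition commutative_hopf_solution (k : fieldType) (V : lmodType k)
    (R : {linear (V ⊗ V)%type -> (V ⊗ V)%type}) : Prop :=
  hopf_solution R /\ leg12 R \o leg13 R =1 leg13 R \o leg12 R.

(* hopf_map is m ⊗ n |-> \sum n_<1> · m ⊗ n_<0>. *)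
Section HopfMap.
Variables (k : fieldType) (H : algType k) (B : bialgebra H) (M : lmodType k).
Variable X : hopf_module B M.

Definition hopf_map_pure (m n0 : M) (n1 : H) : M ⊗ M := act X n1 m ⊗ n0.

Fact hopf_map_pure_is_bilinear m : is_bilinear (hopf_map_pure m).
Proof.
split=> [h|n] a x y /=; rewrite /hopf_map_pure; first by rewrite linearPr.
by rewrite !linearPl.
Qed.
HB.instance Definition _ m := bilinear_isBilinear.Build k M H (tensor M M) _ _
  (hopf_map_pure m) (hopf_map_pure_is_bilinear m).

Definition hopf_map_coact (m n : M) : M ⊗ M :=
  tlift (hopf_map_pure m) (coact X n).

Fact hopf_map_coact_is_bilinear : is_bilinear hopf_map_coact.
Proof.
split=> [n|m] a x y /=; rewrite /hopf_map_coact; last by rewrite !linearP.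
rewrite /tlift scaler_sumr -big_split; apply: eq_bigr => p _ /=.
by rewrite /hopf_map_pure linearPr linearPl.
Qed.
HB.instance Definition _ := bilinear_isBilinear.Build k M M (tensor M M) _ _
  hopf_map_coact hopf_map_coact_is_bilinear.

Definition hopf_map : M ⊗ M -> M ⊗ M := tlift hopf_map_coact.
HB.instance Definition _ := GRing.Linear.on hopf_map.

Lemma hopf_mapE m n : hopf_map (m ⊗ n) = tlift (hopf_map_pure m) (coact X n).
Proof. exact: tliftE. Qed.

End HopfMap.

(* Main.v *)
(* With n_<0> ⊗ n_<1> the coaction on n, both sides of the Hopf equation send
   m ⊗ n ⊗ p to the image of one element of M ⊗ H ⊗ H under the linear map
     p' ⊗ h ⊗ g |-> (\sum g n_<1> · m ⊗ h · n_<0>) ⊗ p'.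
   On the left the element is (coact ⊗ id) (coact p); on the right, by the
   compatibility of coact with the action, it is (id ⊗ comul) (coact p).
   Coassociativity of the comodule identifies the two. *)
Require Import Defs.
From mathcomp Require Import all_boot all_order all_algebra.
From HB Require Import structures.

Import GRing.Theory.
Local Open Scope ring_scope.

Lemma tensor3_ext (k : fieldType) (U V W Z : lmodType k)
    (f g : {linear (U ⊗ V ⊗ W)%type -> Z}) :
  (forall u v w, f (u ⊗ v ⊗ w) = g (u ⊗ v ⊗ w)) -> f =1 g.
Proof.
move=> fg; apply: tensor_ext => x w; elim/tensor_ind: x => [|u v|x y fgx fgy].
- by rewrite linear0l !linear0.
- exact: fg.
- by rewrite linearDl !linearD fgx fgy.
Qed.

Section Legs.
Variables (k : fieldType) (V : lmodType k).
Implicit Type R : {linear (V ⊗ V)%type -> (V ⊗ V)%type}.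

Lemma leg12E R u v w : leg12 R (u ⊗ v ⊗ w) = R (u ⊗ v) ⊗ w.
Proof. exact: tmapE. Qed.

Lemma leg23E R u v w : leg23 R (u ⊗ v ⊗ w) = tassoc_inv (u ⊗ R (v ⊗ w)).
Proof. by rewrite /leg23 /= tassocE tmapE. Qed.

Lemma leg13E R u v w :
  leg13 R (u ⊗ v ⊗ w) = leg23 (@tswap k V V) (R (u ⊗ w) ⊗ v).
Proof. by rewrite /leg13 /= leg23E /= tswapE tassoc_invE leg12E. Qed.

End Legs.

Section HopfMap.
Variables (k : fieldType) (H : algType k) (B : bialgebra H) (M : lmodType k).
Variable X : hopf_module B M.

Local Notation R := (hopf_map X).
(** A chosen finite list of pairs representing the coaction on [n]. For [q] in it, [q.1] stands for
    n_<0> and [q.2] for n_<1>, so Sweedler sums become big sums. *)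
Local Notation rho n := (repr (coact X n)).

Lemma hopf_map_sum m n :
  R (m ⊗ n) = \sum_(q <- rho n) act X q.2 m ⊗ q.1.
Proof. exact: hopf_mapE. Qed.

Lemma leg12_hopf_map m n p :
  leg12 R (m ⊗ n ⊗ p) = \sum_(q <- rho n) act X q.2 m ⊗ q.1 ⊗ p.
Proof. by rewrite leg12E /= hopf_map_sum linear_sumlz. Qed.

Lemma leg23_hopf_map m n p :
  leg23 R (m ⊗ n ⊗ p) = \sum_(q <- rho p) m ⊗ act X q.2 n ⊗ q.1.
Proof.
rewrite leg23E /= hopf_map_sum linear_sumr linear_sum.
by apply: eq_bigr => q _; apply: tassoc_invE.
Qed.

Lemma leg13_hopf_map m n p :
  leg13 R (m ⊗ n ⊗ p) = \sum_(q <- rho p) act X q.2 m ⊗ n ⊗ q.1.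
Proof.
rewrite leg13E /= hopf_map_sum linear_sumlz linear_sum.
by apply: eq_bigr => q _; rewrite /= leg23E /= tswapE tassoc_invE.
Qed.

(** This is the formula for R (m ⊗ h · n) with [comul B h] freed to an arbitrary tensor [x], so that
    it can also be evaluated on pure tensors. *)
Definition hopf_twist (m n : M) (x : (H ⊗ H)%type) : (M ⊗ M)%type :=
  tlift (hopf_map_pure X m) (tmap2 (act X) (@alg_mul k H) x (coact X n)).

Fact hopf_twist_is_linear m n : linear (hopf_twist m n).
Proof. by move=> a x y; rewrite /hopf_twist linearPl linearP. Qed.
HB.instance Definition _ m n := GRing.isLinear.Build k (tensor H H) (tensor M M)
  _ (hopf_twist m n) (hopf_twist_is_linear m n).

Lemma hopf_twist_comul m n h :
  hopf_twist m n (comul B h) = R (m ⊗ act X h n).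
Proof. by rewrite hopf_mapE coact_act. Qed.

Lemma hopf_twistE m n h g :
  hopf_twist m n (h ⊗ g) =
  \sum_(q <- rho n) act X g (act X q.2 m) ⊗ act X h q.1.
Proof.
rewrite /hopf_twist {1}[coact X n]tensor_sum linear_sumr linear_sum.
apply: eq_bigr => q _.
by rewrite /= tmap2E tliftE /= /hopf_map_pure /alg_mul actM.
Qed.

(** The swap is needed because coactions keep the M-component of p in front, while the legs leave it
    in the third position. *)
Definition hopf_twist3 (m n : M) (x : (M ⊗ (H ⊗ H))%type) : (M ⊗ M ⊗ M)%type :=
  tswap (tmap idfun (hopf_twist m n) x).
HB.instance Definition _ m n := GRing.Linear.copy (hopf_twist3 m n)
  (@tswap k M (tensor M M) \o tmap idfun (hopf_twist m n)).

Lemma hopf_twist3E m n p x :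
  hopf_twist3 m n (p ⊗ x) = hopf_twist m n x ⊗ p.
Proof. by rewrite /hopf_twist3 tmapE tswapE. Qed.

Lemma leg12_leg23_hopf_map m n p :
  leg12 R (leg23 R (m ⊗ n ⊗ p)) =
  hopf_twist3 m n (tmap idfun (comul B) (coact X p)).
Proof.
rewrite leg23_hopf_map [coact X p in RHS]tensor_sum.
rewrite [tmap _ _ _]linear_sum !linear_sum; apply: eq_bigr => q _.
by rewrite /= leg12E tmapE hopf_twist3E hopf_twist_comul.
Qed.

Lemma leg23_leg13_leg12_hopf_map m n p :
  leg23 R (leg13 R (leg12 R (m ⊗ n ⊗ p))) =
  hopf_twist3 m n (tassoc (tmap (coact X) idfun (coact X p))).
Proof.
rewrite leg12_hopf_map [leg13 _ _]linear_sum [leg23 _ _]linear_sum /=.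
under eq_bigr => r _ do rewrite leg13_hopf_map [leg23 _ _]linear_sum /=.
(* The right side expands the coaction on [p] first, so the sum over [rho p] has to be moved outside
   the one over [rho n]. *)
rewrite exchange_big [coact X p in RHS]tensor_sum [tmap _ _ _]linear_sum.
rewrite [tassoc _]linear_sum [RHS]linear_sum; apply: eq_bigr => q _ /=.
under eq_bigr => r _ do rewrite leg23_hopf_map.
(* Likewise the sum over [rho q.1] moves outside; the sum over [rho n] left inside is the one in
   [hopf_twistE], with h = [s.2] and g = [q.2]. *)
rewrite exchange_big tmapE [coact X q.1 in RHS]tensor_sum linear_sumlz.
rewrite [tassoc _]linear_sum [RHS]linear_sum; apply: eq_bigr => s _ /=.
by rewrite tassocE hopf_twist3E hopf_twistE linear_sumlz.
Qed.

Lemma hopf_map_solution : hopf_solution R.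
Proof.
apply: tensor3_ext => m n p /=.
by rewrite leg23_leg13_leg12_hopf_map leg12_leg23_hopf_map coactA.
Qed.

(** R^12 and R^13 both act on the first factor only, through n_<1> and p_<1> respectively, and
    replace n by n_<0> and p by p_<0>. The two composites thus differ only in the order of the
    product of n_<1> and p_<1>. *)
Lemma hopf_map_commutative : (forall g h : H, g * h = h * g) ->
  leg12 R \o leg13 R =1 leg13 R \o leg12 R.
Proof.
move=> mulHC; apply: tensor3_ext => m n p /=.
rewrite leg13_hopf_map leg12_hopf_map.
rewrite [leg12 _ _]linear_sum [leg13 _ _]linear_sum /=.
under eq_bigr => q _ do rewrite leg12_hopf_map.
under [RHS]eq_bigr => q _ do rewrite leg13_hopf_map.
rewrite exchange_big; apply: eq_bigr => r _; apply: eq_bigr => q _ /=.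
by rewrite -!actM mulHC.
Qed.

End HopfMap.

Theorem proposition3p7 (k : fieldType) (H : algType k) (B : bialgebra H)
    (M : lmodType k) (X : hopf_module B M) :
  hopf_solution (hopf_map X) /\
  ((forall g h : H, g * h = h * g) -> commutative_hopf_solution (hopf_map X)).
Proof.
split=> [|mulHC]; first exact: hopf_map_solution.
by split; [exact: hopf_map_solution | exact: hopf_map_commutative].
Qed.
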